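(* Let $L$ be a loop with Nuclear-holomorph $H(L)$. Then $L$ is an IP-Burn-SIP-SBNL if and only if $H(L)$ is an IP-Burn-SIP-SBNL.
   Context: Mappings are written on the right, so $\alpha\beta$ means first $\alpha$, then $\beta$. For a loop $(L,\cdot)$ let $Aum(L,\cdot)$ be its automorphism group. The holomorph $H(L)=(H,\circ)$ is the loop on the set $H$ of pairs $(\alpha,x)$ with $\alpha\in Aum(L,\cdot)$, $x\in L$, with operation $(\alpha,x)\circ(\beta,y)=(\alpha\beta,\ x\beta\cdot y)$. The symbol $x^{-1}$ denotes the two-sided inverse of $x$ (assumed to exist in $L$). The nucleus $N(L)$ is the set of $a\in L$ with $a\cdot xy=ax\cdot y$, $x\cdot ay=xa\cdot y$, $x\cdot ya=xy\cdot a$ for all $x,y\in L$. $H(L)$ is called a Nuclear-holomorph of $L$ if $x^{-1}\cdot x\alpha\in N(L)$ or $x\alpha\cdot x^{-1}\in N(L)$ for all $x\in L$ and $\alpha\in Aum(L,\cdot)$. A loop is an inverse property loop (IPL) if every element $x$ has an inverse $x^{-1}$ such that $x^{-1}\cdot(x\cdot y)=y=(y\cdot x)\cdot x^{-1}$ for all $y$. A Bol loop is a loop satisfying the (right) Bol identity $(xy\cdot z)y=x(yz\cdot y)$. A loop is conjugacy closed if its set of left translations is closed under conjugation by left translations and its set of right translations is closed under conjugation by right translations (in each case including conjugation by inverses of translations). A Burn loop is a Bol loop that is conjugacy closed. A loop is a SIPL (resp. SBNL) if it has at least one non-trivial subloop that is an IPL (resp. a Burn loop). An IP-Burn-SIP-SBNL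 is a loop that is an IPL, a Burn loop, a SIPL and a SBNL. *)

(* Defs.v *)
From HB Require Import structures.
From Stdlib Require Import FunctionalExtensionality ProofIrrelevance.
#[warnings="-notation-overridden"]
From mathcomp Require Import all_boot.

Set Implicit Arguments.
Unset Strict Implicit.
Unset Printing Implicit Defensive.

Import Algebra.

Local Open Scope group_scope.

(* Loops on an arbitrary carrier. They do not extend umagmaType, which would
   force a choice operator on the carrier. *)
HB.mixin Record BaseUMagma_isLoop L of BaseUMagma L := {
  loop_1mul : left_id (1 : L) *%g;
  loop_mul1 : right_id (1 : L) *%g;
  loop_ldiv : forall a b : L, exists! x : L, a * x = b;
  loop_rdiv : forall a b : L, exists! y : L, y * a = b
}.

#[short(type="loopType")]
HB.structure Definition Loop := {L of BaseUMagma_isLoop L & BaseUMagma L}.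

Section LoopDefs.
Variable L : loopType.
Implicit Types (x y z : L) (f g : L -> L).

Definition two_sided_inverse x y := x * y = 1 /\ y * x = 1.

Definition has_inverses := forall x, exists y, two_sided_inverse x y.

Definition nucleus (a : L) := forall x y,
  [/\ a * (x * y) = (a * x) * y, x * (a * y) = (x * a) * y
    & x * (y * a) = (x * y) * a].

Definition is_IPL := forall x, exists x',
  two_sided_inverse x x' /\ forall y, x' * (x * y) = y /\ (y * x) * x' = y.

Definition is_Bol := forall x y z, ((x * y) * z) * y = x * ((y * z) * y).

Definition left_translation f := exists x, f =1 (fun y => x * y).

Definition right_translation f := exists x, f =1 (fun y => y * x).

Definition conj_closed (S : (L -> L) -> Prop) :=
  forall f f' g, S f -> S g -> cancel f f' -> cancel f' f ->
  S (f' \o g \o f) /\ S (f \o g \o f').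

Definition is_conjugacy_closed :=
  conj_closed left_translation /\ conj_closed right_translation.

Definition is_Burn := is_Bol /\ is_conjugacy_closed.

Record aum := Aum {
  aum_fun :> L -> L;
  aumM : {morph aum_fun : x y / x * y};
  aum_bij : bijective aum_fun
}.

Record subloop := Subloop {
  sub_mem :> L -> Prop;
  sub_mem1 : sub_mem 1;
  sub_memM : forall x y, sub_mem x -> sub_mem y -> sub_mem (x * y);
  sub_mem_ldiv : forall a b, sub_mem a -> sub_mem b ->
    exists2 x, sub_mem x & a * x = b;
  sub_mem_rdiv : forall a b, sub_mem a -> sub_mem b ->
    exists2 y, sub_mem y & y * a = b
}.

(* S may be the whole loop; only S = {1} is excluded. *)
Definition nontrivial (S : subloop) := exists2 x, S x & x <> 1.

End LoopDefs.

Section SubloopLoop.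
Variables (L : loopType) (S : subloop L).

Definition subloop_sort := {x : L | S x}.

Definition subloop_mul (u v : subloop_sort) : subloop_sort :=
  exist _ (sval u * sval v) (sub_memM (svalP u) (svalP v)).

HB.instance Definition _ := hasMul.Build subloop_sort subloop_mul.
HB.instance Definition _ := hasOne.Build subloop_sort (exist _ 1 (sub_mem1 S)).

Lemma subloop_inj (u v : subloop_sort) : sval u = sval v -> u = v.
Proof.
by case: u v => [x Sx] [y Sy] /= exy; subst y; rewrite (proof_irrelevance _ Sx Sy).
Qed.

Lemma subloop_1mul : left_id (1 : subloop_sort) *%g.
Proof. by move=> u; apply: subloop_inj; apply: loop_1mul. Qed.

Lemma subloop_mul1 : right_id (1 : subloop_sort) *%g.
Proof. by move=> u; apply: subloop_inj; apply: loop_mul1. Qed.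

Lemma subloop_ldiv (a b : subloop_sort) : exists! x : subloop_sort, a * x = b.
Proof.
have [x Sx axb] := sub_mem_ldiv (svalP a) (svalP b).
exists (exist _ x Sx); split=> [|u aub]; apply: subloop_inj => //=.
have [w [_ uniq_w]] := loop_ldiv (sval a) (sval b).
by rewrite -(uniq_w _ axb); apply: uniq_w; rewrite -aub.
Qed.

Lemma subloop_rdiv (a b : subloop_sort) : exists! y : subloop_sort, y * a = b.
Proof.
have [x Sx xab] := sub_mem_rdiv (svalP a) (svalP b).
exists (exist _ x Sx); split=> [|u uab]; apply: subloop_inj => //=.
have [w [_ uniq_w]] := loop_rdiv (sval a) (sval b).
by rewrite -(uniq_w _ xab); apply: uniq_w; rewrite -uab.
Qed.

HB.instance Definition _ := BaseUMagma_isLoop.Build subloop_sort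
  subloop_1mul subloop_mul1 subloop_ldiv subloop_rdiv.

End SubloopLoop.

Section Holomorph.
Variable L : loopType.
Implicit Types (a b : aum L) (x y : L).

Lemma aum_inj a b : a =1 b -> a = b.
Proof.
case: a b => [f fM fB] [g gM gB] /= /functional_extensionality efg; subst g.
by rewrite (proof_irrelevance _ fM gM) (proof_irrelevance _ fB gB).
Qed.

Lemma aum1 a : a 1 = 1.
Proof.
have [w [_ uniq_w]] := loop_ldiv (a 1) (a 1).
rewrite -(uniq_w (a 1)); first by apply: uniq_w; rewrite loop_mul1.
by rewrite -aumM loop_1mul.
Qed.

Definition aum_id : aum L := @Aum L id (fun _ _ => erefl) (inv_bij (fun _ => erefl)).

Lemma aum_compM a b : {morph b \o a : x y / x * y}.
Proof. by move=> x y; rewrite /= !aumM. Qed.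

(* Maps act on the right: aum_comp a b is a followed by b. *)
Definition aum_comp a b : aum L :=
  Aum (@aum_compM a b) (bij_comp (aum_bij b) (aum_bij a)).

Lemma aum_ldiv a c : exists b, aum_comp a b = c.
Proof.
have [a' aK a'K] := aum_bij a.
have cM : {morph c \o a' : x y / x * y}.
  move=> x y /=; rewrite -aumM; congr (c _).
  by rewrite -{1}(a'K x) -{1}(a'K y) -aumM aK.
have cB : bijective (c \o a') by apply: bij_comp (aum_bij c) _; exists a.
by exists (Aum cM cB); apply: aum_inj => x /=; rewrite aK.
Qed.

Lemma aum_rdiv a c : exists b, aum_comp b a = c.
Proof.
have [a' aK a'K] := aum_bij a.
have cM : {morph a' \o c : x y / x * y}.
  by move=> x y /=; apply: (can_inj aK); rewrite !aumM !a'K.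
have cB : bijective (a' \o c) by apply: bij_comp _ (aum_bij c); exists a.
by exists (Aum cM cB); apply: aum_inj => x /=; rewrite a'K.
Qed.

Lemma aum_ldivI a b c : aum_comp a b = aum_comp a c -> b = c.
Proof.
have [a' aK a'K] := aum_bij a => /(congr1 (@aum_fun L)) e.
by apply: aum_inj => x; rewrite -(a'K x); apply: (congr1 (@^~ (a' x)) e).
Qed.

Lemma aum_rdivI a b c : aum_comp b a = aum_comp c a -> b = c.
Proof.
move=> /(congr1 (@aum_fun L)) e; apply: aum_inj => x.
by apply: (bij_inj (aum_bij a)); apply: (congr1 (@^~ x) e).
Qed.

Definition holomorph : Type := (aum L * L)%type.

Definition holomorph_mul (u v : holomorph) : holomorph :=
  (aum_comp u.1 v.1, v.1 u.2 * v.2).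

HB.instance Definition _ := hasMul.Build holomorph holomorph_mul.
HB.instance Definition _ := hasOne.Build holomorph (aum_id, 1).

Lemma holomorph_1mul : left_id (1 : holomorph) *%g.
Proof.
move=> [a x]; congr pair; first by apply: aum_inj.
by rewrite /= aum1 loop_1mul.
Qed.

Lemma holomorph_mul1 : right_id (1 : holomorph) *%g.
Proof.
by move=> [a x]; congr pair; [apply: aum_inj | rewrite /= loop_mul1].
Qed.

Lemma holomorph_ldiv (u v : holomorph) : exists! w : holomorph, u * w = v.
Proof.
case: u v => [a x] [c z].
have [b abc] := aum_ldiv a c; have [y [xyz uniq_y]] := loop_ldiv (b x) z.
exists (b, y); split=> [|[b' y']]; first by congr pair.
move=> [ec ez]; have eb : b = b'.
  by apply: (@aum_ldivI a); rewrite abc -ec.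
by subst b'; congr pair; apply: uniq_y.
Qed.

Lemma holomorph_rdiv (u v : holomorph) : exists! w : holomorph, w * u = v.
Proof.
case: u v => [a x] [c z].
have [b bac] := aum_rdiv a c; have [t [txz uniq_t]] := loop_rdiv x z.
have [a' aK a'K] := aum_bij a.
exists (b, a' t); split=> [|[b' y']].
  by congr pair => //=; rewrite a'K.
move=> [ec ez]; congr pair; first by apply: (@aum_rdivI a); rewrite bac -ec.
by rewrite (uniq_t _ ez) aK.
Qed.

HB.instance Definition _ := BaseUMagma_isLoop.Build holomorph
  holomorph_1mul holomorph_mul1 holomorph_ldiv holomorph_rdiv.

(* To be used together with [has_inverses L]; x' is then the inverse of x. *)
Definition is_nuclear_holomorph :=
  forall (x x' : L) (a : aum L), two_sided_inverse x x' ->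
    nucleus (x' * a x) \/ nucleus (a x * x').

End Holomorph.

Section Smarandache.
Variable L : loopType.

Definition is_SIPL :=
  exists2 S : subloop L, nontrivial S & is_IPL (subloop_sort S).

Definition is_SBNL :=
  exists2 S : subloop L, nontrivial S & is_Burn (subloop_sort S).

Definition is_IP_Burn_SIP_SBNL :=
  [/\ is_IPL L, is_Burn L, is_SIPL & is_SBNL].

End Smarandache.

(* Main.v *)
Require Import Defs.
From Stdlib Require Import ClassicalEpsilon.
#[warnings="-notation-overridden"]
From mathcomp Require Import all_boot.

Set Implicit Arguments.
Unset Strict Implicit.
Unset Printing Implicit Defensive.

Import Algebra.

Local Open Scope group_scope.

(** The whole loop may serve as its own distinguished subloop, so an IP Burn
    loop satisfies the two Smarandache conditions as soon as it has an element
    other than [1].  Now [L] and its holomorph are nontrivial together, since a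
    nonidentity automorphism must move some nonidentity element.  What has to be
    compared is therefore: the inverse property, the Bol identity, and conjugacy
    closedness.

    From the holomorph down to [L], these three properties are inherited along
    the injective morphism [x |-> (1, x)].  Conjugacy closedness is existential
    in nature, but the translation that it provides is determined by one of its
    values, and this value lies in the image of [L].

    From [L] up to the holomorph, the inverse property always lifts: the inverse
    of [(a, x)] is [(a^-1, a^-1 (x^-1))].  For the other identities, cancelling
    the automorphisms common to both sides leaves an identity of [L] in which
    one occurrence of some [x] is twisted into [a x] for an automorphism [a],
    for instance [((x * a y) * z) * y = x * ((a y * z) * y)] for the Bol
    identity.  Nuclearity of the holomorph and the inverse property of [L] say
    that [a x = x * n] or [a x = n * x] with [n] in the nucleus; such an [n] can
    be moved through the brackets until it is absorbed into a neighbouring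
    variable or factored out, and what remains is the untwisted identity. *)

(** * Translations and conjugacy closedness *)

Lemma inj_surj_bij (T : Type) (f : T -> T) :
  injective f -> (forall y, exists x, f x = y) -> bijective f.
Proof.
move=> f_inj f_surj.
pose g y := sval (constructive_indefinite_description _ (f_surj y)).
have gK : cancel g f by move=> y; rewrite /g; case: constructive_indefinite_description.
by exists g => // x; apply: f_inj; rewrite gK.
Qed.

Section Translations.
Variable L : loopType.
Implicit Types (a b w x y z n : L).

Lemma loop_mulI a x y : a * x = a * y -> x = y.
Proof.
have [w [_ uniq_w]] := loop_ldiv a (a * y).
by move=> e; rewrite -(uniq_w _ e); apply: uniq_w.
Qed.

Lemma loop_mulIr a x y : x * a = y * a -> x = y.
Proof.
have [w [_ uniq_w]] := loop_rdiv a (y * a).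
by move=> e; rewrite -(uniq_w _ e); apply: uniq_w.
Qed.

Lemma loop_ldiv_ex a b : exists x, a * x = b.
Proof. by have [x [e _]] := loop_ldiv a b; exists x. Qed.

Lemma loop_rdiv_ex a b : exists x, x * a = b.
Proof. by have [x [e _]] := loop_rdiv a b; exists x. Qed.

Lemma left_translation_bij x : bijective (fun y => x * y).
Proof. by apply: inj_surj_bij => [y z|]; [apply: loop_mulI | apply: loop_ldiv_ex]. Qed.

Lemma right_translation_bij x : bijective (fun y => y * x).
Proof. by apply: inj_surj_bij => [y z|]; [apply: loop_mulIr | apply: loop_rdiv_ex]. Qed.

(** Closure of the family [T] under conjugation and inverse conjugation, with
    the inverses of the translations multiplied away. *)
Definition conj_exchange (T : L -> L -> L) :=
  (forall x y, exists w, forall z, T w (T x z) = T x (T y z)) /\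
  (forall x y, exists w, forall z, T x (T w z) = T y (T x z)).

Lemma conj_closedE (T : L -> L -> L) : (forall x, bijective (T x)) ->
  conj_closed (fun f => exists x, f =1 T x) <-> conj_exchange T.
Proof.
move=> T_bij; split=> [cc|[exch exchV] f f' g [x fE] [y gE] fK f'K].
  split=> x y; have [T' TK T'K] := T_bij x;
    have [[w wE] [w' w'E]] := cc (T x) T' (T y)
      (ex_intro _ x (frefl _)) (ex_intro _ y (frefl _)) TK T'K.
  - by exists w' => z; rewrite -w'E /= TK.
  - by exists w => z; rewrite -wE /= T'K.
split.
- have [w wE] := exchV x y; exists w => z /=.
  by rewrite gE (fE z) -wE -fE fK.
- have [w wE] := exch x y; exists w => z /=.
  by rewrite gE fE -wE -fE f'K.
Qed.

Lemma conjugacy_closedE :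
  is_conjugacy_closed L <->
  conj_exchange (fun x z => x * z) /\ conj_exchange (fun x z => z * x).
Proof.
have [l1 l2] := conj_closedE left_translation_bij.
have [r1 r2] := conj_closedE right_translation_bij.
by split=> -[l r]; split; [apply: l1 | apply: r1 | apply: l2 | apply: r2].
Qed.

End Translations.

(** * Inheritance along injective morphisms *)

Section Embedding.
Variables (L M : loopType) (f : L -> M).
Hypotheses (f_inj : injective f) (fM : {morph f : x y / x * y}).

Lemma morph1 : f 1 = 1.
Proof. by apply: (@loop_mulI _ (f 1)); rewrite -fM !loop_mul1. Qed.

Lemma IPL_embed : is_IPL M -> is_IPL L.
Proof.
move=> ipM x; have [x' [[xx' x'x] x'K]] := ipM (f x).
have [r rx] := loop_rdiv_ex x 1.
have fr : f r = x' by apply: (@loop_mulIr _ (f x)); rewrite -fM rx morph1 x'x.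
exists r; split=> [|y].
  by split=> //; apply: f_inj; rewrite fM fr morph1.
by have [e1 e2] := x'K (f y); split; apply: f_inj; rewrite !fM fr.
Qed.

Lemma Bol_embed : is_Bol M -> is_Bol L.
Proof. by move=> bolM x y z; apply: f_inj; rewrite !fM. Qed.

(** A translation of [M] given by conjugation of translations by elements of
    [f L] maps some element of [f L] into [f L]; division in [L] then shows that
    it is itself the translation by an element of [f L]. *)
Lemma conj_exchange_embed (T : L -> L -> L) (T' : M -> M -> M) :
    (forall x z, f (T x z) = T' (f x) (f z)) ->
    (forall a b, exists w, T w a = b) -> (forall a b, exists w, T a w = b) ->
    (forall a x y, T' x a = T' y a -> x = y) ->
    (forall a x y, T' a x = T' a y -> x = y) ->
  conj_exchange T' -> conj_exchange T.
Proof.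
move=> fT div1 div2 can1 can2 [exch exchV]; split=> x y.
- have [w wE] := exch (f x) (f y).
  have [v vE] := div1 (T x 1) (T x (T y 1)).
  have fv : f v = w.
    by apply: (can1 (f (T x 1))); rewrite -fT vE !fT wE.
  by exists v => z; apply: f_inj; rewrite !fT fv wE.
- have [w wE] := exchV (f x) (f y).
  have [u uE] := div2 x (T y (T x 1)); have [v vE] := div1 1 u.
  have fv : f v = w.
    by apply: (can1 (f 1)); apply: (can2 (f x)); rewrite -!fT vE uE !fT wE.
  by exists v => z; apply: f_inj; rewrite !fT fv wE.
Qed.

Lemma Burn_embed : is_Burn M -> is_Burn L.
Proof.
move=> [bolM /conjugacy_closedE [exchl exchr]].
split; first exact: Bol_embed.
apply/conjugacy_closedE; split.
- apply: conj_exchange_embed exchl => //=.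
  + exact: loop_rdiv_ex.
  + exact: loop_ldiv_ex.
  + exact: loop_mulIr.
  + exact: loop_mulI.
- apply: conj_exchange_embed exchr => //=.
  + exact: loop_ldiv_ex.
  + exact: loop_rdiv_ex.
  + exact: loop_mulI.
  + exact: loop_mulIr.
Qed.

End Embedding.

(** * Smarandache conditions on an IP Burn loop *)

Section WholeSubloop.
Variable L : loopType.

Definition whole_subloop : subloop L.
Proof.
refine (@Subloop L (fun _ => True) I (fun _ _ _ _ => I) _ _) => a b _ _.
- by have [x e] := loop_ldiv_ex a b; exists x.
- by have [x e] := loop_rdiv_ex a b; exists x.
Defined.

Lemma IP_Burn_SIP_SBNLE :
  is_IP_Burn_SIP_SBNL L <-> [/\ is_IPL L, is_Burn L & exists x : L, x <> 1].
Proof.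
split=> [[ip burn [S [x _ x1] _] _]|[ip burn [x x1]]].
  by split=> //; exists x.
have nt : nontrivial whole_subloop by exists x.
have val_inj : injective (sval : subloop_sort whole_subloop -> L).
  by move=> u v; apply: subloop_inj.
split=> //; exists whole_subloop => //.
- exact: (IPL_embed val_inj).
- exact: (Burn_embed val_inj).
Qed.

End WholeSubloop.

(** * Identities twisted by a nuclear factor *)

Section NuclearTwist.
Variable L : loopType.
Implicit Types (n w x y z : L).

Definition nuclear_associate x y :=
  (exists2 n, nucleus n & y = x * n) \/ (exists2 n, nucleus n & y = n * x).

Lemma nucl n x y : nucleus n -> n * (x * y) = (n * x) * y.
Proof. by move=> /(_ x y) []. Qed.

Lemma nucm n x y : nucleus n -> x * (n * y) = (x * n) * y.
Proof. by move=> /(_ x y) []. Qed.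

Lemma nucr n x y : nucleus n -> x * (y * n) = (x * y) * n.
Proof. by move=> /(_ x y) []. Qed.

(** The inverse property is what recovers [a x] from [x^-1 * a x] or from
    [a x * x^-1]. *)
Lemma aum_nuclear_associate : is_IPL L -> is_nuclear_holomorph L ->
  forall (a : aum L) x, nuclear_associate x (a x).
Proof.
move=> ip hnuc a x; have [x' [inv_x x'K]] := ip x.
case: (hnuc x x' a inv_x) => nuc_n; [left | right].
- exists (x' * a x) => //; have [t <-] := loop_ldiv_ex x (a x).
  by rewrite (x'K t).1.
- exists (a x * x') => //; have [t <-] := loop_rdiv_ex x (a x).
  by rewrite (x'K t).2.
Qed.

Lemma Bol_twist x y y' z : is_Bol L -> nuclear_associate y y' ->
  ((x * y') * z) * y = x * ((y' * z) * y).
Proof.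
move=> bol [] [n N_n ->].
- by rewrite (nucr _ _ N_n) -!(nucm _ _ N_n) bol.
- by rewrite (nucm _ _ N_n) bol -(nucm _ _ N_n) !(nucl _ _ N_n).
Qed.

Section Exchange.
Variables (x x' : L).
Hypothesis xx' : nuclear_associate x x'.

(** In each of these four exchanges the nuclear factor either slides next to
    [y], or next to the unknown [w], or comes out on the left of both sides;
    where it has to be undone, division by [n] in the loop suffices. *)
Lemma left_exchange_twist y : conj_exchange (fun u z : L => u * z) ->
  exists w, forall z, w * (x * z) = x' * (y * z).
Proof.
move=> [exch _]; case: xx' => [] [n N_n ->].
- have [w wE] := exch x (n * y); exists w => z.
  by rewrite wE -(nucl _ _ N_n) (nucm _ _ N_n).
- have [w wE] := exch x y; exists (n * w) => z.
  by rewrite -(nucl _ _ N_n) wE (nucl _ _ N_n).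
Qed.

Lemma left_exchangeV_twist y : conj_exchange (fun u z : L => u * z) ->
  exists w, forall z, x' * (w * z) = y * (x * z).
Proof.
move=> [_ exchV]; case: xx' => [] [n N_n ->].
- have [w wE] := exchV x y; have [v vE] := loop_ldiv_ex n w; exists v => z.
  by rewrite -(nucm _ _ N_n) (nucl _ _ N_n) vE wE.
- have [v vE] := loop_ldiv_ex n y; have [w wE] := exchV x v; exists w => z.
  by rewrite -(nucl _ _ N_n) wE (nucl _ _ N_n) vE.
Qed.

Lemma right_exchange_twist y : conj_exchange (fun u z : L => z * u) ->
  exists w, forall z, (z * x') * w = (z * y) * x.
Proof.
move=> [exch _]; case: xx' => [] [n N_n ->].
- have [w wE] := exch x y; have [v vE] := loop_ldiv_ex n w; exists v => z.
  by rewrite (nucr _ _ N_n) -(nucm _ _ N_n) vE wE.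
- have [v vE] := loop_ldiv_ex n y; have [w wE] := exch x v; exists w => z.
  by rewrite (nucm _ _ N_n) wE -(nucm _ _ N_n) vE.
Qed.

Lemma right_exchangeV_twist y : conj_exchange (fun u z : L => z * u) ->
  exists w, forall z, (z * w) * x = (z * x') * y.
Proof.
move=> [_ exchV]; case: xx' => [] [n N_n ->].
- have [w wE] := exchV x (n * y); exists w => z.
  by rewrite wE (nucr _ _ N_n) (nucm _ _ N_n).
- have [w wE] := exchV x y; exists (n * w) => z.
  by rewrite !(nucm _ _ N_n) wE.
Qed.

End Exchange.
End NuclearTwist.

(** * Lifting to the holomorph *)

Section Lifting.
Variable L : loopType.
Implicit Types (a b c d : aum L) (x y z : L).

Lemma holomorph_eq (a b : aum L) x y :
  a =1 b -> x = y -> ((a, x) : holomorph L) = (b, y).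
Proof. by move=> /aum_inj -> ->. Qed.

Lemma aum_surj a y : exists x, a x = y.
Proof. by have [a' _ a'K] := aum_bij a; exists (a' y). Qed.

Lemma aum_comp_ldiv a c : exists b, forall x, b (a x) = c x.
Proof. by have [b <-] := aum_ldiv a c; exists b. Qed.

Lemma aum_comp_rdiv a c : exists b, forall x, a (b x) = c x.
Proof. by have [b <-] := aum_rdiv a c; exists b. Qed.

Lemma IPL_holomorph : is_IPL L -> is_IPL (holomorph L).
Proof.
move=> ip [a x].
have [b abK] := aum_comp_ldiv a (aum_id L).
have baK : cancel b a.
  by move=> y; have [z <-] := aum_surj a y; rewrite abK.
have [x' [[xx' x'x] x'K]] := ip x.
exists (b, b x'); split.
  split; apply: holomorph_eq => [s|] /=; rewrite ?abK ?baK //.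
  by rewrite -aumM xx' aum1.
move=> [c y]; split; apply: holomorph_eq => [s|] /=.
- by rewrite baK.
- have [t <-] := aum_surj c y.
  by rewrite baK -!aumM (x'K t).1.
- by rewrite abK.
- have [t <-] := aum_surj b y.
  by rewrite -aumM baK (x'K t).2.
Qed.

Hypothesis assoc : forall a x, nuclear_associate x (a x).

Lemma Bol_holomorph : is_Bol L -> is_Bol (holomorph L).
Proof.
move=> bol [a x] [b y] [c z]; apply: holomorph_eq => //=.
by rewrite !aumM; apply: Bol_twist bol (assoc (aum_comp c b) y).
Qed.

(** The automorphism part of the wanted element is found by division in the
    automorphism group, and its loop part by an exchange in [L] where [x] is
    twisted by [b] or by its conjugate [d]. When the wanted element stands to the
    left of [(a, x)], its loop part gets acted on by [a], so that a preimage
    under [a] has to be taken. *)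
Lemma conj_exchange_holomorph_left :
  conj_exchange (fun x z : L => x * z) ->
  conj_exchange (fun u t : holomorph L => u * t).
Proof.
move=> exch; split=> -[a x] [b y].
- have [d dE] := aum_comp_rdiv a (aum_comp a b).
  have [w wE] := left_exchange_twist (assoc b x) y exch.
  have [v vE] := aum_surj a w.
  exists (d, v) => -[c z]; apply: holomorph_eq => [s|] /=.
    by rewrite dE.
  have [t <-] := aum_surj c z.
  by rewrite vE -!aumM wE.
- have [d dE] := aum_comp_ldiv a (aum_comp b a).
  have [w wE] := left_exchangeV_twist (assoc d x) (a y) exch.
  exists (d, w) => -[c z]; apply: holomorph_eq => [s|] /=.
    by rewrite dE.
  have [t <-] := aum_surj c z.
  by rewrite -!aumM wE.
Qed.

Lemma conj_exchange_holomorph_right :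
  conj_exchange (fun x z : L => z * x) ->
  conj_exchange (fun u t : holomorph L => t * u).
Proof.
move=> exch; split=> -[a x] [b y].
- have [d dE] := aum_comp_ldiv a (aum_comp b a).
  have [w wE] := right_exchange_twist (assoc d x) (a y) exch.
  exists (d, w) => -[c z]; apply: holomorph_eq => [s|] /=.
    by rewrite dE.
  by rewrite !aumM dE /= wE.
- have [d dE] := aum_comp_rdiv a (aum_comp a b).
  have [w wE] := right_exchangeV_twist (assoc b x) y exch.
  have [v vE] := aum_surj a w.
  exists (d, v) => -[c z]; apply: holomorph_eq => [s|] /=.
    by rewrite dE.
  by rewrite !aumM dE /= vE wE.
Qed.

Lemma Burn_holomorph : is_Burn L -> is_Burn (holomorph L).
Proof.
move=> [bol /conjugacy_closedE [exchl exchr]].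
split; first exact: Bol_holomorph.
apply/conjugacy_closedE; split.
- exact: conj_exchange_holomorph_left.
- exact: conj_exchange_holomorph_right.
Qed.

End Lifting.

(** * The embedding of the loop into its holomorph *)

Section HolomorphEmbedding.
Variable L : loopType.

Definition holomorph_in (x : L) : holomorph L := (aum_id L, x).

Lemma holomorph_in_inj : injective holomorph_in.
Proof. by move=> x y []. Qed.

Lemma holomorph_inM : {morph holomorph_in : x y / x * y}.
Proof. by move=> x y; apply: holomorph_eq. Qed.

Lemma holomorph_nontrivial :
  (exists u : holomorph L, u <> 1) <-> (exists x : L, x <> 1).
Proof.
split=> [[[a x] ax1]|[x x1]]; last by exists (holomorph_in x) => -[].
apply: NNPP => triv.
have all1 y : y = 1 :> L by apply: NNPP => y1; apply: triv; exists y.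
by apply: ax1; apply: holomorph_eq => [s|]; [rewrite (all1 s) aum1 | apply: all1].
Qed.

End HolomorphEmbedding.

Theorem corollary3p4 (L : loopType) (hinv : has_inverses L)
  (hnuc : is_nuclear_holomorph L) :
  is_IP_Burn_SIP_SBNL L <-> is_IP_Burn_SIP_SBNL (holomorph L).
Proof.
have [nt_down nt_up] := holomorph_nontrivial L.
split=> /IP_Burn_SIP_SBNLE [ip burn nt]; apply/IP_Burn_SIP_SBNLE.
- split; [exact: IPL_holomorph | | exact: nt_up].
  by apply: Burn_holomorph burn; apply: aum_nuclear_associate.
- split; last exact: nt_down.
  + exact: IPL_embed (@holomorph_in_inj L) (@holomorph_inM L) ip.
  + exact: Burn_embed (@holomorph_in_inj L) (@holomorph_inM L) burn.
Qed.
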